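(* Let $\pi$ be a $\mathbf{BiInt}$-proof of a sequent $\Gamma\Rightarrow\Delta$ whose last (lowest) inference is an instance of cut that is not analytic, and such that every other instance of cut in $\pi$ is analytic. Then $\Gamma\Rightarrow\Delta$ has a locally analytic $\mathbf{BiInt}$-proof (and such a proof can be effectively obtained from $\pi$).
   Context: Formulas are built from propositional atoms and constants $\top,\bot$ using binary connectives $\land,\lor,\supset$ (implication) and $\prec$ (coimplication). A sequent is $\Gamma\Rightarrow\Delta$ with $\Gamma,\Delta$ finite multisets of formulas. The calculus $\mathbf{BiInt}$ has the following rules (in each, $\Gamma,\Delta$ are arbitrary multisets, $p$ an atom): initial sequents $\Gamma,p\Rightarrow p,\Delta$; cut: from $\Gamma\Rightarrow A,\Delta$ and $\Gamma,A\Rightarrow\Delta$ infer $\Gamma\Rightarrow\Delta$; left/right weakening and left/right contraction; $\top_L$: from $\Gamma\Rightarrow\Delta$ infer $\Gamma,\top\Rightarrow\Delta$; $\top_R$: $\Gamma\Rightarrow\top,\Delta$ is an axiom; $\bot_L$: $\Gamma,\bot\Rightarrow\Delta$ is an axiom; $\bot_R$: from $\Gamma\Rightarrow\Delta$ infer $\Gamma\Rightarrow\bot,\Delta$; $\land_L$: from $\Gamma,A,B\Rightarrow\Delta$ infer $\Gamma,A\land B\Rightarrow\Delta$; $\land_R$: from $\Gamma\Rightarrow A,\Delta$ and $\Gamma\Rightarrow B,\Delta$ infer $\Gamma\Rightarrow A\land B,\Delta$; $\lor_L$: from $\Gamma,A\Rightarrow\Delta$ and $\Gamma,B\Rightarrow\Delta$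 infer $\Gamma,A\lor B\Rightarrow\Delta$; $\lor_R$: from $\Gamma\Rightarrow A,B,\Delta$ infer $\Gamma\Rightarrow A\lor B,\Delta$; $\supset_L$: from $\Gamma,A\supset B\Rightarrow A,\Delta$ and $\Gamma,A\supset B,B\Rightarrow\Delta$ infer $\Gamma,A\supset B\Rightarrow\Delta$; $\supset_R$: from $\Gamma,A\Rightarrow B$ infer $\Gamma\Rightarrow A\supset B,\Delta$; $\prec_L$: from $A\Rightarrow B,\Delta$ infer $\Gamma,A\prec B\Rightarrow\Delta$; $\prec_R$: from $\Gamma\Rightarrow A,A\prec B,\Delta$ and $\Gamma,B\Rightarrow A\prec B,\Delta$ infer $\Gamma\Rightarrow A\prec B,\Delta$. A proof is a finite tree of rule instances whose leaves are axioms. An instance of cut with conclusion $\Gamma\Rightarrow\Delta$ and cut-formula $A$ is analytic if $A$ is a subformula of some formula in $\Gamma\cup\Delta$. A proof is locally analytic if every cut in it is analytic. *)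

(* Defs.v *)
From HB Require Import structures.
From mathcomp Require Import all_boot.
From mathcomp Require Import finmap multiset.

Set Implicit Arguments.
Unset Strict Implicit.
Unset Printing Implicit Defensive.

Local Open Scope mset_scope.

(* [Imp] is the implication and [Coimp] the coimplication ([A] excludes [B]). *)
Inductive formula (atom : Type) : Type :=
| Atom of atom
| Top
| Bot
| And of formula atom & formula atom
| Or of formula atom & formula atom
| Imp of formula atom & formula atom
| Coimp of formula atom & formula atom.

Arguments Top {atom}.
Arguments Bot {atom}.

(* The encoding into generic trees only serves to equip formulas with the
   choice structure required by [{mset _}]. *)
Fixpoint tree_of_formula (atom : Type) (A : formula atom) : GenTree.tree atom :=
  match A with
  | Atom p => GenTree.Leaf p
  | Top => GenTree.Node 0 [::]
  | Bot => GenTree.Node 1 [::]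
  | And B C => GenTree.Node 2 [:: tree_of_formula B; tree_of_formula C]
  | Or B C => GenTree.Node 3 [:: tree_of_formula B; tree_of_formula C]
  | Imp B C => GenTree.Node 4 [:: tree_of_formula B; tree_of_formula C]
  | Coimp B C => GenTree.Node 5 [:: tree_of_formula B; tree_of_formula C]
  end.

Fixpoint formula_of_tree (atom : Type) (t : GenTree.tree atom) :
    option (formula atom) :=
  let bin c t1 t2 :=
    if formula_of_tree t1 is Some B then
      if formula_of_tree t2 is Some C then Some (c B C) else None
    else None in
  match t with
  | GenTree.Leaf p => Some (Atom p)
  | GenTree.Node 0 [::] => Some Top
  | GenTree.Node 1 [::] => Some Bot
  | GenTree.Node 2 [:: t1; t2] => bin (@And atom) t1 t2
  | GenTree.Node 3 [:: t1; t2] => bin (@Or atom) t1 t2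
  | GenTree.Node 4 [:: t1; t2] => bin (@Imp atom) t1 t2
  | GenTree.Node 5 [:: t1; t2] => bin (@Coimp atom) t1 t2
  | _ => None
  end.

Lemma tree_of_formulaK (atom : Type) :
  pcancel (@tree_of_formula atom) (@formula_of_tree atom).
Proof. by elim=> //= B -> C ->. Qed.

HB.instance Definition _ (atom : countType) :=
  Countable.copy (formula atom) (pcan_type (@tree_of_formulaK atom)).

Fixpoint subformulas (atom : Type) (A : formula atom) : seq (formula atom) :=
  A :: match A with
       | Atom _ | Top | Bot => [::]
       | And B C | Or B C | Imp B C | Coimp B C =>
           subformulas B ++ subformulas C
       end.

(* [proof G D] is the type of proof trees with end-sequent [G => D]. It lives in
   [Type], so that the inferences of a proof can be inspected and a proof can be
   returned as data. The sequent "G, A => B, D" is written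
   [A +` G], [B +` D]. *)
Inductive proof (atom : countType) :
    {mset formula atom} -> {mset formula atom} -> Type :=
| Init G D p : proof (Atom p +` G) (Atom p +` D)
| Cut G D A : proof G (A +` D) -> proof (A +` G) D -> proof G D
| WeakL G D A : proof G D -> proof (A +` G) D
| WeakR G D A : proof G D -> proof G (A +` D)
| ContrL G D A : proof (A +` (A +` G)) D -> proof (A +` G) D
| ContrR G D A : proof G (A +` (A +` D)) -> proof G (A +` D)
| TopL G D : proof G D -> proof (Top +` G) D
| TopR G D : proof G (Top +` D)
| BotL G D : proof (Bot +` G) D
| BotR G D : proof G D -> proof G (Bot +` D)
| AndL G D A B : proof (A +` (B +` G)) D -> proof (And A B +` G) D
| AndR G D A B :
    proof G (A +` D) -> proof G (B +` D) -> proof G (And A B +` D)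
| OrL G D A B :
    proof (A +` G) D -> proof (B +` G) D -> proof (Or A B +` G) D
| OrR G D A B : proof G (A +` (B +` D)) -> proof G (Or A B +` D)
| ImpL G D A B :
    proof (Imp A B +` G) (A +` D) -> proof (B +` (Imp A B +` G)) D ->
    proof (Imp A B +` G) D
| ImpR G D A B : proof (A +` G) [mset B] -> proof G (Imp A B +` D)
| CoimpL G D A B : proof [mset A] (B +` D) -> proof (Coimp A B +` G) D
| CoimpR G D A B :
    proof G (A +` (Coimp A B +` D)) -> proof (B +` G) (Coimp A B +` D) ->
    proof G (Coimp A B +` D).

(* [G => D] is the conclusion of the cut and [A] its cut-formula. *)
Definition analytic_cut (atom : countType) (G D : {mset formula atom})
    (A : formula atom) : Prop :=
  exists2 B, B \in G `+` D & A \in subformulas B.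

Fixpoint locally_analytic (atom : countType) (G D : {mset formula atom})
    (pi : proof G D) : Prop :=
  match pi with
  | Init _ _ _ | TopR _ _ | BotL _ _ => True
  | @Cut _ G D A pi1 pi2 =>
      [/\ analytic_cut G D A, locally_analytic pi1 & locally_analytic pi2]
  | WeakL _ _ _ pi1 | WeakR _ _ _ pi1 | ContrL _ _ _ pi1 | ContrR _ _ _ pi1
  | TopL _ _ pi1 | BotR _ _ pi1 | AndL _ _ _ _ pi1 | OrR _ _ _ _ pi1
  | ImpR _ _ _ _ pi1 | CoimpL _ _ _ _ pi1 => locally_analytic pi1
  | AndR _ _ _ _ pi1 pi2 | OrL _ _ _ _ pi1 pi2 | ImpL _ _ _ _ pi1 pi2
  | CoimpR _ _ _ _ pi1 pi2 => locally_analytic pi1 /\ locally_analytic pi2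
  end.

(* The cuts of [pi] other than its last inference are exactly the cuts of its
   immediate subproofs. *)
Definition only_last_cut_nonanalytic (atom : countType)
    (G D : {mset formula atom}) (pi : proof G D) : Prop :=
  match pi with
  | @Cut _ G D A pi1 pi2 =>
      [/\ ~ analytic_cut G D A, locally_analytic pi1 & locally_analytic pi2]
  | _ => False
  end.

(* Main.v *)
(** The argument is semantic and constructive: soundness for Kripke models plus
completeness of the locally analytic fragment. A world is a pair (T, F) of
disjoint finite sets, true and false formulas, such that T :|: F is closed under
subformulas; the set T :|: F varies from world to world. Analytic cuts suffice
to extend any underivable sequent s => t to such a world inside the subformulas
of s and t themselves, so that a witness for an implication false at (T, F) is a
world over the possibly smaller set of subformulas of T, A, B. Worlds are
ordered by growing T and shrinking F; the witness is above (T, F) because it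
contains T and lies inside T :|: F. Coimplication is dual. Starting from all
candidate worlds, those lacking a required witness are discarded one by one;
each discarded world is a locally analytically derivable sequent. What remains
is a finite Kripke model, in which the given sequent would be refuted if it had
no locally analytic proof. *)

Require Import Defs.
From mathcomp Require Import all_boot.
From mathcomp Require Import finmap multiset.

Set Implicit Arguments.
Unset Strict Implicit.
Unset Printing Implicit Defensive.

Local Open Scope mset_scope.

(** * Kripke semantics *)

Section Kripke.

Variables (atom : countType) (K : eqType) (W : seq K).
Variables (le : rel K) (val : K -> pred atom).
Hypotheses (le_refl : reflexive le) (le_trans : transitive le).
Hypothesis val_mono : forall w v p, le w v -> val w p -> val v p.

Fixpoint forces (w : K) (A : formula atom) : bool :=
  match A with
  | Atom p => val w p
  | Top => true
  | Bot => false
  | And B C => forces w B && forces w C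
  | Or B C => forces w B || forces w C
  | Imp B C => all (fun v => [==> le w v, forces v B => forces v C]) W
  | Coimp B C => has (fun v => [&& le v w, forces v B & ~~ forces v C]) W
  end.

(** [Imp] looks only upwards and [Coimp] only downwards, so for both transitivity of [le] suffices,
    without an induction hypothesis. *)
Lemma forces_mono w v A : le w v -> forces w A -> forces v A.
Proof.
move=> lewv; elim: A => //= [p | B IHB C IHC | B IHB C IHC | B _ C _ | B _ C _].
- exact: val_mono.
- by case/andP => /IHB -> /IHC ->.
- by case/orP => [/IHB -> // | /IHC ->]; rewrite orbT.
- move=> /allP H; apply/allP => u Wu; apply/implyP => levu.
  by have := H u Wu; rewrite (le_trans lewv levu).
- case/hasP => u Wu /andP[leuw H]; apply/hasP; exists u => //.
  by rewrite (le_trans leuw lewv).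
Qed.

Lemma all_mset1D (P : pred (formula atom)) A (G : {mset formula atom}) :
  all P (A +` G) = P A && all P G.
Proof.
by rewrite -[RHS]/(all P (A :: G)); apply: eq_all_r => B; rewrite in_mset1D inE.
Qed.

Lemma has_mset1D (P : pred (formula atom)) A (G : {mset formula atom}) :
  has P (A +` G) = P A || has P G.
Proof.
by rewrite -[RHS]/(has P (A :: G)); apply: eq_has_r => B; rewrite in_mset1D inE.
Qed.

Lemma soundness (G D : {mset formula atom}) :
  proof G D -> forall w, w \in W -> all (forces w) G -> has (forces w) D.
Proof.
have E := (all_mset1D, has_mset1D).
elim=> {G D} [G D p|G D A _ I1 _ I2|G D A _ I|G D A _ I|G D A _ I|G D A _ I
  |G D _ I|G D|G D|G D _ I|G D A B _ I|G D A B _ I1 _ I2|G D A B _ I1 _ I2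
  |G D A B _ I|G D A B _ I1 _ I2|G D A B _ I|G D A B _ I|G D A B _ I1 _ I2]
  w Ww; rewrite ?E /=.
- by case/andP => ->.
- move=> Gw; move: (I1 w Ww) (I2 w Ww); rewrite !E Gw.
  by case: (forces w A) => /= H1 H2; [apply: H2 | apply: H1].
- case/andP=> _; exact: I.
- by move=> /(I w Ww) ->; rewrite orbT.
- by case/andP => Aw Gw; apply: I => //; rewrite !E Aw.
- by move=> /(I w Ww); rewrite !E orbA orbb.
- exact: I.
- by [].
- by [].
- exact: I.
- by rewrite -andbA; move: (I w Ww); rewrite !E.
- move=> Gw; move: (I1 w Ww Gw) (I2 w Ww Gw); rewrite !E.
  by rewrite orb_andl => -> ->.
- by case/andP => /orP[] H Gw; [apply: I1 | apply: I2]; rewrite // E H.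
- by rewrite -orbA; move: (I w Ww); rewrite !E.
- case/andP => H Gw; move: (I1 w Ww) (I2 w Ww); rewrite !E /= H Gw /=.
  have := allP H w Ww; rewrite le_refl /=.
  case: (forces w A) (forces w B) => [] [] /= HAB H1 H2;
    by rewrite ?H1 ?H2 ?HAB.
(* The premise has lost [D], so it is used at each [v] above [w], where [G] still holds by
   persistence. *)
- move=> Gw; apply/orP; left; apply/allP => v Wv; apply/implyP => lewv.
  apply/implyP => Av; have := I v Wv; rewrite E Av /=.
  have -> : all (forces v) G.
    by apply/allP => C GC; apply: (forces_mono lewv); apply: (allP Gw).
  by rewrite enum_msetn /= orbF; apply.
(* Dually, the premise is used at the witness [v] below [w], and the formula of [D] found true there
   persists up to [w]. *)
- case/andP => /hasP[v Wv /and3P[levw Av Bv]] _.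
  have := I v Wv; rewrite E enum_msetn /= Av (negPf Bv) /= => /(_ isT).
  case/hasP => C DC Cv; apply/hasP; exists C => //.
  exact: forces_mono levw Cv.
- move=> Gw; move: (I1 w Ww Gw) (I2 w Ww); rewrite !E /= Gw andbT.
  case Aw: (forces w A) => /=; last by move=> H _; exact: H.
  case Bw: (forces w B) => /=; first by move=> _; apply.
  move=> _ _; apply/orP; left; apply/hasP; exists w => //.
  by rewrite le_refl Aw Bw.
Qed.

End Kripke.

(** * Locally analytic derivability *)

Section Derivability.

Variable atom : countType.
Implicit Types (A B C : formula atom) (s t u : seq (formula atom)).

(** Stated on sequences, so that finite sets and multisets alike can be read as the sides of a
    sequent. *)
Definition derivable s t :=
  {rho : proof (seq_mset s) (seq_mset t) | locally_analytic rho}.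

Definition subformulas_seq s := flatten [seq subformulas A | A <- s].

Lemma seq_mset_nil : seq_mset [::] = mset0 :> {mset formula atom}.
Proof. by apply/msetP => A; rewrite mset_seqE mset0E. Qed.

Lemma seq_mset_cons A s : seq_mset (A :: s) = A +` seq_mset s.
Proof. by apply/msetP => B; rewrite mset1DE !mset_seqE /= eq_sym. Qed.

Lemma mem_seq_mset s : seq_mset s =i s.
Proof. exact: perm_mem (perm_eq_seq_mset s). Qed.

Lemma subformulas_refl A : A \in subformulas A.
Proof. by case: A => *; rewrite mem_head. Qed.

Lemma subformulas_trans A B C :
  A \in subformulas B -> B \in subformulas C -> A \in subformulas C.
Proof.
move=> AB; elim: C => [p|||D ID E IE|D ID E IE|D ID E IE|D ID E IE] /=;
  rewrite in_cons => /predU1P[BE | //]; try by rewrite BE in AB.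
all: rewrite in_cons !mem_cat => H; apply/orP; right; move: H.
all: by case/orP => [/ID -> | /IE ->  ]; rewrite ?orbT.
Qed.

Lemma sub_subformulas_seq s : {subset s <= subformulas_seq s}.
Proof.
by move=> A sA; apply/flatten_mapP; exists A; rewrite ?subformulas_refl.
Qed.

Lemma subformulas_seq_sub s t :
  {subset s <= subformulas_seq t} ->
  {subset subformulas_seq s <= subformulas_seq t}.
Proof.
move=> st A /flatten_mapP[B /st /flatten_mapP[C tC BC] AB].
by apply/flatten_mapP; exists C => //; apply: subformulas_trans BC.
Qed.

(** * Structural rules and analytic cut *)

Lemma derivable_perm s s' t t' :
  perm_eq s s' -> perm_eq t t' -> derivable s t -> derivable s' t'.
Proof. by rewrite /derivable => /eq_seq_msetP -> /eq_seq_msetP ->. Qed.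

Lemma derivable_weak s t u v : derivable s t -> derivable (u ++ s) (v ++ t).
Proof.
move=> st; have {st}: derivable s (v ++ t).
  elim: v => //= A v [r lr]; rewrite /derivable seq_mset_cons.
  by exists (WeakR A r).
elim: u => //= A u IH /IH[r lr]; rewrite /derivable seq_mset_cons.
by exists (WeakL A r).
Qed.

Lemma derivable_contr s t u v :
  {subset u <= s} -> {subset v <= t} ->
  derivable (u ++ s) (v ++ t) -> derivable s t.
Proof.
move=> us vt; have : derivable (u ++ s) (v ++ t) -> derivable (u ++ s) t.
  elim: v vt => //= A v IH vt H; apply: IH => [B vB|].
    by apply: vt; rewrite inE vB orbT.
  have pA : perm_eq (v ++ t) (A :: rem A (v ++ t)).
    by apply: perm_to_rem; rewrite mem_cat vt ?orbT ?mem_head.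
  apply: (derivable_perm (perm_refl _)); first by rewrite perm_sym; exact: pA.
  have := derivable_perm (perm_refl _) _ H => /(_ (A :: A :: rem A (v ++ t))).
  rewrite perm_cons => /(_ pA); rewrite /derivable !seq_mset_cons.
  by case=> r lr; exists (ContrR r).
move=> H /H; elim: u us {H} => //= A u IH us H; apply: IH => [B uB|].
  by apply: us; rewrite inE uB orbT.
have pA : perm_eq (u ++ s) (A :: rem A (u ++ s)).
  by apply: perm_to_rem; rewrite mem_cat us ?orbT ?mem_head.
apply: (derivable_perm _ (perm_refl _)); first by rewrite perm_sym; exact: pA.
have := derivable_perm _ (perm_refl _) H => /(_ (A :: A :: rem A (u ++ s))).
rewrite perm_cons => /(_ pA); rewrite /derivable !seq_mset_cons.
by case=> r lr; exists (ContrL r).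
Qed.

(** Weaken by all of [s'] and [t'], then contract away [s] and [t], whose members recur. From here
    on sequents behave as pairs of sets. *)
Lemma derivable_sub s s' t t' :
  {subset s <= s'} -> {subset t <= t'} -> derivable s t -> derivable s' t'.
Proof.
move=> ss' tt' /(derivable_weak s' t') H; apply: (derivable_contr ss' tt').
by apply: derivable_perm H; rewrite perm_catC.
Qed.

Lemma cons_subset A s : A \in s -> {subset A :: s <= s}.
Proof. by move=> sA B /predU1P[-> |]. Qed.

Lemma derivable_memL A s t : A \in s -> derivable (A :: s) t -> derivable s t.
Proof. by move=> /cons_subset sA; apply: derivable_sub. Qed.

Lemma derivable_memR A s t : A \in t -> derivable s (A :: t) -> derivable s t.
Proof. by move=> /cons_subset tA; apply: derivable_sub. Qed.

Lemma derivable_cut A s t :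
  A \in subformulas_seq (s ++ t) ->
  derivable s (A :: t) -> derivable (A :: s) t -> derivable s t.
Proof.
move=> /flatten_mapP stA; rewrite /derivable !seq_mset_cons.
case=> r lr [r' lr']; exists (Cut r r'); split=> //.
case: stA => B stB BA; exists B => //.
by rewrite in_msetD !mem_seq_mset -mem_cat.
Qed.

(** * Logical rules, with the principal formula kept in its context *)

Lemma derivable_top s t : Top \in t -> derivable s t.
Proof.
move=> /derivable_memR; apply; rewrite /derivable seq_mset_cons.
by exists (TopR _ _).
Qed.

Lemma derivable_bot s t : Bot \in s -> derivable s t.
Proof.
move=> /derivable_memL; apply; rewrite /derivable seq_mset_cons.
by exists (BotL _ _).
Qed.

Lemma derivable_andL A B s t :
  And A B \in s -> derivable [:: A, B & s] t -> derivable s t.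
Proof.
move=> /derivable_memL H [r lr]; apply: H; rewrite /derivable seq_mset_cons.
by rewrite !seq_mset_cons in r lr *; exists (AndL r).
Qed.

Lemma derivable_andR A B s t :
  And A B \in t -> derivable s (A :: t) -> derivable s (B :: t) ->
  derivable s t.
Proof.
move=> /derivable_memR H H1 H2; apply: H; move: H1 H2.
rewrite /derivable !seq_mset_cons => -[r lr] [r' lr'].
by exists (AndR r r').
Qed.

Lemma derivable_orL A B s t :
  Or A B \in s -> derivable (A :: s) t -> derivable (B :: s) t ->
  derivable s t.
Proof.
move=> /derivable_memL H H1 H2; apply: H; move: H1 H2.
rewrite /derivable !seq_mset_cons => -[r lr] [r' lr'].
by exists (OrL r r').
Qed.

Lemma derivable_orR A B s t :
  Or A B \in t -> derivable s [:: A, B & t] -> derivable s t.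
Proof.
move=> /derivable_memR H H1; apply: H; move: H1.
by rewrite /derivable !seq_mset_cons => -[r lr]; exists (OrR r).
Qed.

Lemma derivable_impL A B s t :
  Imp A B \in s -> derivable s (A :: t) -> derivable (B :: s) t ->
  derivable s t.
Proof.
move=> sAB H1 H2; apply: (derivable_memL sAB).
have {}H2 : derivable [:: B, Imp A B & s] t.
  by apply: derivable_sub H2 => // C; rewrite !inE => /orP[] ->; rewrite ?orbT.
have {}H1 := derivable_weak [:: Imp A B] [::] H1.
move: H1 H2; rewrite /derivable !seq_mset_cons => -[r lr] [r' lr'].
by exists (ImpL r r').
Qed.

Lemma derivable_impR A B s t :
  Imp A B \in t -> derivable (A :: s) [:: B] -> derivable s t.
Proof.
move=> /derivable_memR H H1; apply: H; move: H1.
rewrite /derivable !seq_mset_cons.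
by rewrite seq_mset_nil msetD0 => -[r lr]; exists (ImpR _ r).
Qed.

Lemma derivable_coimpL A B s t :
  Coimp A B \in s -> derivable [:: A] (B :: t) -> derivable s t.
Proof.
move=> /derivable_memL H H1; apply: H; move: H1.
rewrite /derivable !seq_mset_cons.
by rewrite seq_mset_nil msetD0 => -[r lr]; exists (CoimpL _ r).
Qed.

Lemma derivable_coimpR A B s t :
  Coimp A B \in t -> derivable s (A :: t) -> derivable (B :: s) t ->
  derivable s t.
Proof.
move=> tAB H1 H2; apply: (derivable_memR tAB).
have {}H1 : derivable s [:: A, Coimp A B & t].
  by apply: derivable_sub H1 => // C; rewrite !inE => /orP[] ->; rewrite ?orbT.
have {}H2 := derivable_weak [::] [:: Coimp A B] H2.
move: H1 H2; rewrite /derivable !seq_mset_cons => -[r lr] [r' lr'].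
by exists (CoimpR r r').
Qed.

(** Initial sequents are atomic, hence the induction on [A]. For [Imp] the right rule must come
    first read bottom-up, since it discards the right context; for [Coimp] the left rule, which
    discards the left one. *)
Lemma derivable_id A s t : A \in s -> A \in t -> derivable s t.
Proof.
have E := (mem_head, in_cons, eqxx, orbT).
elim: A s t => [p|||A IA B IB|A IA B IB|A IA B IB|A IA B IB] s t sA tA.
- apply: (derivable_memL sA); apply: (derivable_memR tA).
  by rewrite /derivable !seq_mset_cons; exists (Init _ _ p).
- exact: derivable_top.
- exact: derivable_bot.
- apply: (derivable_andL sA).
  by apply: (derivable_andR tA); [apply: IA | apply: IB]; rewrite ?E.
- apply: (derivable_orR tA).
  by apply: (derivable_orL sA); [apply: IA | apply: IB]; rewrite ?E.
- apply: (derivable_impR tA); apply: (@derivable_impL A B).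
  + by rewrite ?E ?sA ?E.
  + by apply: IA; rewrite ?E.
  + by apply: IB; rewrite ?E.
- apply: (derivable_coimpL sA); apply: (@derivable_coimpR A B).
  + by rewrite ?E ?tA ?E.
  + by apply: IA; rewrite ?E.
  + by apply: IB; rewrite ?E.
Qed.

End Derivability.

(** * The finite countermodel *)

Section Countermodel.

Variable atom : countType.
Implicit Types (A B C : formula atom) (s t l : seq (formula atom)).

Definition world := ({fset formula atom} * {fset formula atom})%type.
Implicit Types (w v : world) (W : seq world).

Definition saturated w :=
  [disjoint w.1 & w.2]%fset &&
  all [in w.1 ++ w.2] (subformulas_seq (w.1 ++ w.2)).

(** Each formula of [S] is placed on the left or on the right by a cut. Once all are placed, the two
    sides either overlap, which gives an identity, or form a saturated world. *)
Lemma extend_saturated s t :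
  (forall w, saturated w -> {subset s <= w.1} -> {subset t <= w.2} ->
     {subset w.1 ++ w.2 <= subformulas_seq (s ++ t)} -> derivable w.1 w.2) ->
  derivable s t.
Proof.
set S := subformulas_seq _ => H.
have stS : {subset s ++ t <= S} by apply: sub_subformulas_seq.
(* [l] lists the formulas of [S] that may still be undecided. *)
suff K l w : {subset s <= w.1} -> {subset t <= w.2} ->
    {subset w.1 ++ w.2 <= S} -> {subset S <= l ++ (w.1 ++ w.2)} ->
    derivable w.1 w.2.
  have sE : [fset x in s]%fset =i s by move=> A; rewrite inE.
  have tE : [fset x in t]%fset =i t by move=> A; rewrite inE.
  have := K S ([fset x in s], [fset x in t])%fset => /= {}K.
  apply: (derivable_sub (s := [fset x in s]%fset) (t := [fset x in t]%fset)).
  - by move=> A; rewrite sE.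
  - by move=> A; rewrite tE.
  apply: K => A; rewrite ?sE ?tE //.
  - by rewrite mem_cat sE tE -mem_cat; apply: stS.
  - by rewrite mem_cat => ->.
elim: l w => [|C l IH] w sw tw wS Sw.
  case: (boolP [disjoint w.1 & w.2]%fset) => [dw|].
    apply: H => //; rewrite /saturated dw; apply/allP => A Aw.
    by apply: Sw; apply: subformulas_seq_sub Aw.
  case: (fset_0Vmem (w.1 `&` w.2)%fset) => [E|[A]].
    by rewrite /fdisjoint E eqxx.
  by rewrite inE => /andP[A1 A2] _; apply: derivable_id A1 A2.
case: (boolP (C \in S)) => SC; last first.
  apply: IH => // A SA; have := Sw A SA; rewrite inE => /predU1P[E|//].
  by rewrite -E SA in SC.
(* The cut on [C] is analytic because [w] still contains [s] and [t]. *)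
have CwS : C \in subformulas_seq (w.1 ++ w.2).
  apply: (@subformulas_seq_sub _ (s ++ t)) SC => A stA.
  apply: sub_subformulas_seq; move: stA; rewrite !mem_cat.
  by case/orP => [/sw | /tw] ->; rewrite ?orbT.
apply: (derivable_cut CwS).
- apply: (@derivable_sub _ w.1 _ (C |` w.2)%fset) => //.
    by move=> A; rewrite !inE.
  apply: (IH (w.1, C |` w.2)%fset) => //= A.
  + by move=> /tw; rewrite !inE => ->; rewrite orbT.
  + rewrite mem_cat !inE => /or3P[Aw|/eqP->//|Aw];
      by apply: wS; rewrite mem_cat Aw ?orbT.
  + move=> /Sw; rewrite !(inE, mem_cat).
    by case/or4P => ->; rewrite ?orbT.
- apply: (@derivable_sub _ (C |` w.1)%fset _ w.2) => //.
    by move=> A; rewrite !inE.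
  apply: (IH (C |` w.1, w.2)%fset) => //= A.
  + by move=> /sw; rewrite !inE => ->; rewrite orbT.
  + rewrite mem_cat !inE -orbA => /or3P[/eqP->//|Aw|Aw];
      by apply: wS; rewrite mem_cat Aw ?orbT.
  + move=> /Sw; rewrite !(inE, mem_cat).
    by case/or4P => ->; rewrite ?orbT.
Qed.

(** * Order on worlds and witnessing conditions *)

Definition le_world w v := (w.1 `<=` v.1)%fset && (v.2 `<=` w.2)%fset.

(* The witnessing conditions of the truth lemma for formulas of [w.1] (true at
   [w]) and of [w.2] (false at [w]). *)
Definition goodL W w A :=
  match A with
  | Atom _ | Top => true
  | Bot => false
  | And B C => (B \in w.1) && (C \in w.1)
  | Or B C => (B \in w.1) || (C \in w.1)
  | Imp B C => (B \in w.2) || (C \in w.1)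
  | Coimp B C => has (fun v => [&& le_world v w, B \in v.1 & C \in v.2]) W
  end.

Definition goodR W w A :=
  match A with
  | Atom _ | Bot => true
  | Top => false
  | And B C => (B \in w.2) || (C \in w.2)
  | Or B C => (B \in w.2) && (C \in w.2)
  | Imp B C => has (fun v => [&& le_world w v, B \in v.1 & C \in v.2]) W
  | Coimp B C => (B \in w.2) || (C \in w.1)
  end.

Definition good W w := all (goodL W w) w.1 && all (goodR W w) w.2.

(** The invariant of the pruning. *)
Definition complete (S : seq (formula atom)) W :=
  forall w, saturated w -> {subset w.1 ++ w.2 <= S} -> w \notin W ->
  derivable w.1 w.2.

Lemma mem_saturated w A B :
  saturated w -> A \in w.1 ++ w.2 -> B \in subformulas A ->
  (B \in w.1) || (B \in w.2).
Proof.
case/andP => _ /allP H wA BA; rewrite -mem_cat; apply: H.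
by apply/flatten_mapP; exists A.
Qed.

(** When a local condition fails, saturation puts the components of [A] on the sides where the left
    rule for [A] closes with identities. Only [Coimp] refers to other worlds. *)
Lemma derivable_not_goodL S W w A :
  complete S W -> saturated w -> {subset w.1 ++ w.2 <= S} ->
  A \in w.1 -> ~~ goodL W w A -> derivable w.1 w.2.
Proof.
move=> cW satw wS wA.
have M B : B \in subformulas A -> (B \in w.1) || (B \in w.2).
  by apply: mem_saturated => //; rewrite mem_cat wA.
have E := (in_cons, mem_cat, subformulas_refl, orbT).
case: A wA M => [p|||B C|B C|B C|B C] //= wA M.
- by move=> _; apply: derivable_bot wA.
- rewrite negb_and => nBC; apply: (derivable_andL wA).
  have := M B; have := M C; rewrite !E => /(_ isT) MC /(_ isT) MB.
  case wB: (B \in w.2).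
    by apply: derivable_id wB; rewrite !inE eqxx ?orbT.
  case wC: (C \in w.2).
    by apply: derivable_id wC; rewrite !inE eqxx ?orbT.
  by exfalso; move: nBC MB MC; rewrite wB wC !orbF => /orP[] /negPf->.
- rewrite negb_or => /andP[nB nC].
  have := M B; have := M C; rewrite !E (negPf nB) (negPf nC).
  move=> /(_ isT) MC /(_ isT) MB.
  by apply: (derivable_orL wA); apply: derivable_id (mem_head _ _) _.
- rewrite negb_or => /andP[nB nC].
  have := M B; have := M C; rewrite !E (negPf nB) (negPf nC) orbF.
  move=> /(_ isT) MC /(_ isT) MB.
  apply: (derivable_impL wA); first exact: derivable_id MB (mem_head _ _).
  exact: derivable_id (mem_head _ _) MC.
- move=> /hasPn nW; apply: (derivable_coimpL wA); apply: extend_saturated.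
  move=> v satv /(_ B) vB vw vS.
  (* [v] only decides subformulas of [B], [C] and [w.2], all of which [w] decides. *)
  have vw' : {subset v.1 ++ v.2 <= w.1 ++ w.2}.
    move=> D /vS /flatten_mapP[D'].
    rewrite inE => /orP[/eqP->|]; [|rewrite inE => /orP[/eqP->|wD]] => DD'.
    + by rewrite mem_cat M // !E DD' ?orbT.
    + by rewrite mem_cat M // !E DD' ?orbT.
    + by rewrite mem_cat (mem_saturated satw _ DD') // mem_cat wD orbT.
  (* A [v] in [W] would be the missing witness, so [v] is outside [W] and derivable by
     completeness. *)
  apply: cW => // [D /vw' /wS //|]; apply/negP => /nW.
  rewrite vB ?mem_head // vw ?mem_head //= andbT /le_world => /negP; apply.
  apply/andP; split; apply/fsubsetP => D vD; last first.
    by apply: vw; rewrite inE vD orbT.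
  (* A formula of [v.1] lying in [w.2] would also lie in [v.2], against disjointness. *)
  have := vw' D; rewrite !mem_cat vD => /(_ isT) /orP[//|wD].
  case/andP: satv => /fdisjointP /(_ _ vD) /negP[].
  by apply: vw; rewrite inE wD orbT.
Qed.

(** Dual argument: here [Imp] is the case that needs another world, and the right rule leaves [w.1]
    in the premise to be extended. *)
Lemma derivable_not_goodR S W w A :
  complete S W -> saturated w -> {subset w.1 ++ w.2 <= S} ->
  A \in w.2 -> ~~ goodR W w A -> derivable w.1 w.2.
Proof.
move=> cW satw wS wA.
have M B : B \in subformulas A -> (B \in w.1) || (B \in w.2).
  by apply: mem_saturated => //; rewrite mem_cat wA orbT.
have E := (in_cons, mem_cat, subformulas_refl, orbT).
case: A wA M => [p|||B C|B C|B C|B C] //= wA M.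
- by move=> _; apply: derivable_top wA.
- rewrite negb_or => /andP[nB nC].
  have := M B; have := M C; rewrite !E (negPf nB) (negPf nC) !orbF.
  move=> /(_ isT) MC /(_ isT) MB.
  by apply: (derivable_andR wA); apply: derivable_id (mem_head _ _).
- rewrite negb_and => nBC; apply: (derivable_orR wA).
  have := M B; have := M C; rewrite !E => /(_ isT) MC /(_ isT) MB.
  case wB: (B \in w.1).
    by apply: derivable_id wB _; rewrite !inE eqxx ?orbT.
  case wC: (C \in w.1).
    by apply: derivable_id wC _; rewrite !inE eqxx ?orbT.
  by exfalso; move: nBC MB MC; rewrite wB wC /= => /orP[] /negPf->.
- move=> /hasPn nW; apply: (derivable_impR wA); apply: extend_saturated.
  move=> v satv wv /(_ C) vC vS.
  have vw' : {subset v.1 ++ v.2 <= w.1 ++ w.2}.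
    move=> D /vS /flatten_mapP[D'].
    rewrite mem_cat mem_seq1 in_cons => /orP[/predU1P[->|wD]|/eqP->] DD'.
    + by rewrite mem_cat M // !E DD' ?orbT.
    + by rewrite mem_cat (mem_saturated satw _ DD') // mem_cat wD.
    + by rewrite mem_cat M // !E DD' ?orbT.
  apply: cW => // [D /vw' /wS //|]; apply/negP => /nW.
  rewrite vC ?mem_head // wv ?mem_head //= andbT /le_world => /negP; apply.
  apply/andP; split; apply/fsubsetP => D vD.
    by apply: wv; rewrite inE vD orbT.
  have := vw' D; rewrite !mem_cat vD orbT => /(_ isT) /orP[wD|//].
  case/andP: satv => /fdisjointP /(_ D) + _; rewrite vD => /(_ _)/negP[] //.
  by apply: wv; rewrite inE wD orbT.
- rewrite negb_or => /andP[nB nC].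
  have := M B; have := M C; rewrite !E (negPf nB) (negPf nC) orbF.
  move=> /(_ isT) MC /(_ isT) MB.
  apply: (derivable_coimpR wA); first exact: derivable_id MB (mem_head _ _).
  exact: derivable_id (mem_head _ _) MC.
Qed.

Lemma derivable_not_good S W w :
  complete S W -> saturated w -> {subset w.1 ++ w.2 <= S} ->
  ~~ good W w -> derivable w.1 w.2.
Proof.
move=> cW satw wS; rewrite negb_and.
(* [sig2W] picks the offending formula as data, since the goal is a proof tree. *)
case: (boolP (all (goodL W w) w.1)) => [_ | /allPn/sig2W[A wA nA] _].
  by move=> /allPn/sig2W[A]; apply: derivable_not_goodR cW satw wS.
exact: derivable_not_goodL cW satw wS wA nA.
Qed.

(** * Pruning the worlds *)

Definition good_model S :=
  {W : seq world & {in W, forall w, saturated w && good W w} & complete S W}.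

(** Removing a world that is not good keeps [W] complete by [derivable_not_good], and the size of
    [W] bounds the number of removals. *)
Lemma good_worlds S : good_model S.
Proof.
suff K n W : size W <= n -> all saturated W ->
    all (fun w => all [in S] (w.1 ++ w.2)) W -> complete S W ->
    good_model S.
  (* Start from all saturated pairs of subsets of [S], for which completeness is vacuous. *)
  pose P := fpowerset [fset A in S]%fset.
  pose W := [seq w <- [seq (T, F) | T <- P, F <- P] | saturated w].
  apply: (K _ W (leqnn _)) => [||w satw wS].
  - exact: filter_all.
  - apply/allP => w; rewrite mem_filter => /andP[_].
    case/allpairsP => -[T F] /= [PT PF ->] /=; apply/allP => A; rewrite mem_cat.
    move: PT PF; rewrite !fpowersetE => /fsubsetP PT /fsubsetP PF.
    by case/orP => [/PT|/PF]; rewrite inE.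
  - case/negP; rewrite mem_filter satw; apply/allpairsP; exists w => /=.
    rewrite !fpowersetE -surjective_pairing.
    split => //; apply/fsubsetP => A Aw;
      by rewrite inE; apply: wS; rewrite mem_cat Aw ?orbT.
elim: n W => [|n IH] W sW satW WS cW.
  by exists W => //; case: W sW {satW WS cW}.
case: (boolP (all (good W) W)) => [/allP gW | /allPn/sig2W[w Ww ngw]].
  by exists W => // w Ww; rewrite gW // (allP satW).
apply: (IH [seq v <- W | v != w]).
- rewrite -ltnS (leq_trans _ sW) // size_filter -(count_predC (pred1 w) W).
  rewrite -[X in X < _]add0n ltn_add2r -has_count; apply/hasP; exists w => //=.
- by apply/allP => v; rewrite mem_filter => /andP[_]; apply: (allP satW).
- by apply/allP => v; rewrite mem_filter => /andP[_]; apply: (allP WS).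
move=> v satv vS; rewrite mem_filter negb_and negbK.
case: eqVneq => [-> _|_]; last exact: cW.
apply: (derivable_not_good cW) ngw; first exact: (allP satW).
exact: (allP (allP WS w Ww)).
Qed.

(** * The truth lemma *)

Definition world_val w p := Atom p \in w.1.

Lemma le_world_refl : reflexive le_world.
Proof. by move=> w; rewrite /le_world !fsubset_refl. Qed.

Lemma le_world_trans : transitive le_world.
Proof.
move=> v w u /andP[wv vw] /andP[vu uv].
by rewrite /le_world (fsubset_trans wv vu) (fsubset_trans uv vw).
Qed.

Lemma world_val_mono w v p : le_world w v -> world_val w p -> world_val v p.
Proof. by case/andP => /fsubsetP wv _; apply: wv. Qed.

(** Truth and falsity are proved together, because [Imp] and [Coimp] each use both for their
    components. *)
Lemma truth_lemma W : {in W, forall w, saturated w && good W w} ->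
  forall A w, w \in W ->
  (A \in w.1 -> forces W le_world world_val w A) /\
  (A \in w.2 -> ~~ forces W le_world world_val w A).
Proof.
move=> satW.
have gL w A : w \in W -> A \in w.1 -> goodL W w A.
  by move=> /satW /andP[_ /andP[/allP gw _]]; apply: gw.
have gR w A : w \in W -> A \in w.2 -> goodR W w A.
  by move=> /satW /andP[_ /andP[_ /allP gw]]; apply: gw.
elim=> [p|||B IB C IC|B IB C IC|B IB C IC|B IB C IC] w Ww; split=> //=.
- move=> w2p; apply/negP => w1p.
  have /andP[/andP[/fdisjointP dw _] _] := satW w Ww.
  by move: (dw _ w1p); rewrite w2p.
- by move=> /(gR w _ Ww) /=.
- by move=> /(gL w _ Ww) /=.
- by move=> /(gL w _ Ww) /= /andP[/(IB w Ww).1 -> /(IC w Ww).1].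
- move=> /(gR w _ Ww) /= /orP[].
    by move=> /(IB w Ww).2 /negPf->.
  by move=> /(IC w Ww).2 /negPf->; rewrite andbF.
- move=> /(gL w _ Ww) /= /orP[/(IB w Ww).1 -> // | /(IC w Ww).1 ->].
  exact: orbT.
- by move=> /(gR w _ Ww) /= /andP[/(IB w Ww).2 /negPf-> /(IC w Ww).2].
(* The implication also belongs to [v.1] for each [v] above [w], so the local condition applies at
   [v]. *)
- move=> wA; apply/allP => v Wv; apply/implyP => /andP[/fsubsetP wv _].
  have /= /orP[vB|vC] := gL v _ Wv (wv _ wA).
    by rewrite (negPf ((IB v Wv).2 vB)).
  by rewrite ((IC v Wv).1 vC) implybT.
- move=> /(gR w _ Ww) /= /hasP[v Wv /and3P[wv vB vC]].
  apply/allPn; exists v => //.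
  by rewrite wv ((IB v Wv).1 vB) (negPf ((IC v Wv).2 vC)).
- move=> /(gL w _ Ww) /= /hasP[v Wv /and3P[wv vB vC]].
  apply/hasP; exists v => //.
  by rewrite wv ((IB v Wv).1 vB) ((IC v Wv).2 vC).
(* Dually, the false coimplication also belongs to [v.2] for each [v] below [w]. *)
- move=> wA; apply/hasPn => v Wv; apply/negP.
  case/and3P => /andP[_ /fsubsetP wv] fB fC.
  have /= /orP[vB|vC] := gR v _ Wv (wv _ wA).
    by move: ((IB v Wv).2 vB); rewrite fB.
  by move: fC; rewrite ((IC v Wv).1 vC).
Qed.

End Countermodel.

Theorem theorem1 (atom : countType) (G D : {mset formula atom})
    (pi : proof G D) :
  only_last_cut_nonanalytic pi -> {rho : proof G D | locally_analytic rho}.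
Proof.
move=> _; suff : derivable G D by rewrite /derivable !seq_mset_id.
have [W gW cW] := good_worlds (subformulas_seq (G ++ D)).
(* A surviving [w] would force all of [G] and nothing in [D], against soundness of [pi]; so every
   saturated extension of the sequent was discarded. *)
apply: extend_saturated => w satw Gw Dw wS; apply: cW => //; apply/negP => Ww.
have := soundness (@le_world_refl _) (@le_world_trans _) (@world_val_mono _)
  pi Ww.
case/(_ _)/hasP => [|A DA].
  by apply/allP => A GA; apply: (truth_lemma gW A Ww).1; apply: Gw.
by apply/negP; apply: (truth_lemma gW A Ww).2; apply: Dw.
Qed.
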